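(* Let $X=[0,1]\subset\mathbb{R}$, let $\boldsymbol{\xi},\boldsymbol{\xi}^1,\boldsymbol{\xi}^2,\ldots$ be iid random variables on a complete probability space $(\Omega,\mathcal{F},\mathbb{P})$, each uniformly distributed on $\Xi=[0,1]$, and let $f:\Xi\times\mathbb{R}\to\mathbb{R}$ be the function defined explicitly in the context. There exists $x\in X$ such that, $\mathbb{P}$-almost surely, one has $$\liminf_{\nu\to\infty}\operatorname{exs}\Big(\partial\Big(\frac1\nu\sum_{i=1}^\nu f(\boldsymbol{\xi}^i,\cdot)\Big)(x);\ \partial\,\mathbb{E}[f(\boldsymbol{\xi},\cdot)](x)\Big)\ge\frac12 .$$
   Context: $\mathbb{N}=\{1,2,\ldots\}$. Definition of $f$: for $\xi\in[0,1]$ and $k\in\mathbb{N}$ let $\mathrm{bit}_k(\xi)=\lfloor 2^k\xi\rfloor-2\lfloor 2^{k-1}\xi\rfloor\in\{0,1\}$. Let $B_k=\{x\in\mathbb{R}\mid |x-\frac1k|<\frac{1}{4k^2}\}$ for $k\in\mathbb{N}$ (these sets are pairwise disjoint), let $g(\xi,x)=\sum_{k=1}^\infty \mathds{1}_{B_k}(x)\,\mathrm{bit}_k(\xi)$, where $\mathds{1}_{B_k}$ is the $\{0,1\}$-valued indicator function of $B_k$, and let $$f(\xi,x)=\int_0^{\max\{x,0\}}g(\xi,t)\,dt .$$ Notation: $\partial\varphi(x)$ denotes the Clarke subdifferential of a locally Lipschitz function $\varphi:\mathbb{R}\to\mathbb{R}$ at $x$; $\mathbb{E}[f(\boldsymbol{\xi},\cdot)]$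 is the function $y\mapsto\mathbb{E}[f(\boldsymbol{\xi},y)]$. For nonempty sets $C,D$, $\operatorname{exs}(C;D)=\sup_{z\in C}\inf_{w\in D}\|z-w\|$ is the excess of $C$ relative to $D$. ''$\mathbb{P}$-almost surely'' means for all $\omega$ in a set of $\mathbb{P}$-probability one (the probability space is complete). *)

(* Defs.v *)
From mathcomp Require Export all_boot all_order all_algebra.
From mathcomp Require Export finmap.
From mathcomp Require Export all_classical all_reals all_analysis.

Set Implicit Arguments.
Unset Strict Implicit.
Unset Printing Implicit Defensive.

Import Order.TTheory GRing.Theory Num.Theory.
Import numFieldNormedType.Exports.

Local Open Scope classical_set_scope.
Local Open Scope ring_scope.

(* The k-th binary digit of z, for k >= 1 (k.-1 is the truncated predecessor). *)
Definition bit {R : realType} (k : nat) (z : R) : R :=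
  (Num.floor (2 ^+ k * z) - 2 * Num.floor (2 ^+ k.-1 * z))%:~R.

Definition B {R : realType} (k : nat) : set R :=
  [set x | `|x - k%:R^-1| < (4 * k%:R ^+ 2)^-1].

(* The sets B k, k >= 1, are pairwise disjoint, so that at most one term of
   the series is nonzero. *)
Definition g {R : realType} (z x : R) : R :=
  limn (fun n : nat => \sum_(1 <= k < n) \1_(B k) x * bit k z).

(* The first argument is meant to range over [0, 1]. *)
Definition f {R : realType} (z x : R) : R :=
  \int[lebesgue_measure]_(t in `[0, Num.max x 0]) g z t.

(* Clarke's generalized directional derivative
   phi°(x; v) = limsup_{y -> x, t -> 0+} (phi (y + t v) - phi y) / t. *)
Definition clarke_dd {R : realType} (phi : R -> R) (x v : R) : \bar R :=
  limf_esup (fun p : R * R => ((phi (p.1 + p.2 * v) - phi p.1) / p.2)%:E)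
    (filter_prod (nbhs x) (0^'+)).

(* Elements of the dual of R are identified with real numbers. *)
Definition clarke_subdiff {R : realType} (phi : R -> R) (x : R) : set R :=
  [set s | forall v : R, ((s * v)%:E <= clarke_dd phi x v)%E].

(* Meaningful for nonempty C and D. *)
Definition exs {R : realType} (C D : set R) : \bar R :=
  ereal_sup [set ereal_inf [set `|z - w|%:E | w in D] | z in C].

(* Mutual independence: the product rule over all finite subfamilies. *)
Definition mutually_independent {d d' : measure_display} {R : realType}
    {T : measurableType d} {T' : measurableType d'} (P : probability T R)
    {I : choiceType} (X : I -> {RV P >-> T'}) : Prop :=
  forall (J : {fset I}) (A : I -> set T'),
    (forall i, i \in J -> measurable (A i)) ->
    (P (\bigcap_(i in [set` J]) (X i @^-1` A i))
     = \prod_(i <- J) P (X i @^-1` A i))%E.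

Definition uniform01 {d : measure_display} {R : realType}
    {T : measurableType d} (P : probability T R) (X : {RV P >-> R}) : Prop :=
  (forall w, X w \in `[0, 1]) /\
  forall A : set R, measurable A ->
    distribution P X A = uniform_prob (@ltr01 R) A.

(* Main.v *)
Require Import Defs.
From mathcomp Require Import measurable_realfun zify ring lra.
Import Order.TTheory GRing.Theory Num.Theory.
Import numFieldNormedType.Exports.
Local Open Scope classical_set_scope.
Local Open Scope ring_scope.

(* Take x = 0. Each binary digit of a uniform variable has mean 1/2 and the sets
   B k are disjoint, so y |-> E[f(xi, y)] has increments at most half those of y
   and its Clarke subdifferential at 0 lies below 1/2. On the other hand, almost
   surely, for every nu there are infinitely many k at which the k-th digits of
   xi^1, ..., xi^nu are all 1; on such a B k the sample mean has slope 1, and these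
   B k accumulate at 0, so 1 belongs to the Clarke subdifferential of the sample
   mean at 0. *)

(** * Binary digits: counting and measuring dyadic sets *)

Lemma sum_nat_double (h : nat -> nat) (n : nat) :
  (\sum_(m < n.*2) h m = \sum_(m < n) (h m.*2 + h m.*2.+1))%N.
Proof.
elim: n => [|n IHn]; first by rewrite !big_ord0.
by rewrite doubleS !big_ord_recr/= IHn addnA.
Qed.

Lemma doubleD_divn_exp2 (b : bool) (m i : nat) :
  ((b + m.*2) %/ 2 ^ i.+1 = m %/ 2 ^ i)%N.
Proof. by rewrite expnS divnMA divn2 half_bit_double. Qed.

(** Induction on [i]: at place [i.+1], both [m.*2] and [m.*2.+1] carry the bit that [m] has at place
    [i], so the count doubles. At [i = 0] it counts odd numbers. *)
Lemma sum_odd_divn_exp2 (i k : nat) :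
  (\sum_(m < 2 ^ (k.+1 + i)) odd (m %/ 2 ^ i) = 2 ^ (k + i))%N.
Proof.
elim: i => [|i IHi].
  rewrite !addn0 expnS mul2n (sum_nat_double (fun m => odd (m %/ 2 ^ 0))).
  under eq_bigr do rewrite expn0 !divn1/= odd_double.
  by rewrite sum_nat_const card_ord muln1.
rewrite !addnS expnS mul2n (sum_nat_double (fun m => odd (m %/ 2 ^ i.+1))).
rewrite [in RHS]expnS mul2n -addnn -IHi -big_split/=.
apply: eq_bigr => m _.
by rewrite (doubleD_divn_exp2 false) (doubleD_divn_exp2 true).
Qed.

(** Even numbers contribute nothing, and halving the odd ones reduces to the count for a single bit:
    two distinct bits are both set in a quarter of the cases. *)
Lemma sum_odd_odd_divn_exp2 (i k : nat) :
  (\sum_(m < 2 ^ (k.+2 + i)) (odd m && odd (m %/ 2 ^ i.+1)) = 2 ^ (k + i))%N.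
Proof.
rewrite addSn expnS mul2n.
rewrite (sum_nat_double (fun m => odd m && odd (m %/ 2 ^ i.+1))).
rewrite -[RHS]sum_odd_divn_exp2.
apply: eq_bigr => m _.
by rewrite oddS odd_double (doubleD_divn_exp2 true).
Qed.

(** A condition on the first [l] binary digits of [z], given through the integer that they form. The
    point [1], whose truncation would need one more digit, is left out. *)
Definition dyadic_set {R : realType} (l : nat) (Q : pred nat) : set R :=
  [set z | 0 <= z < 1 /\ Q (Num.trunc (2 ^+ l * z))].

(** Dropping the last [i] of [k + i] binary digits is integer division by [2 ^ i]; this lets several
    digits be read off one truncation. *)
Lemma truncn_mul_exp2 {R : realType} (z : R) (k i : nat) : 0 <= z ->
  Num.trunc (2 ^+ k * z) = (Num.trunc (2 ^+ (k + i) * z) %/ 2 ^ i)%N.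
Proof.
move=> z0; set t := Num.trunc (2 ^+ (k + i) * z).
have zi : 0 <= 2 ^+ (k + i) * z by rewrite mulr_ge0// exprn_ge0.
have zk : 0 <= 2 ^+ k * z by rewrite mulr_ge0// exprn_ge0.
have /andP[tl tr] := truncn_itv zi.
apply: truncn_def; rewrite -(ler_pM2r (_ : 0 < 2 ^+ i)) ?exprn_gt0//.
rewrite -(ltr_pM2r (_ : 0 < 2 ^+ i) (2 ^+ k * z)) ?exprn_gt0//.
rewrite mulrAC -exprD -natrX -!natrM; apply/andP; split.
  by rewrite (le_trans _ tl)// ler_nat leq_trunc_div.
by rewrite (lt_le_trans tr)// ler_nat -/t ltn_ceil// expn_gt0.
Qed.

Lemma dyadic_set_bigcup {R : realType} (l : nat) (Q : pred nat) :
  dyadic_set l Q = \big[setU/set0]_(m < 2 ^ l | Q m)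
    [set` `[m%:R / 2 ^+ l, m.+1%:R / 2 ^+ l[ ] :> set R.
Proof.
have l0 : (0 : R) < 2 ^+ l by rewrite exprn_gt0.
rewrite big_mkcond -(bigcup_mkord _ (fun m =>
  if Q m then [set` `[m%:R / 2 ^+ l, m.+1%:R / 2 ^+ l[ ] else set0)).
apply/seteqP; split => [z [/andP[z0 z1] Qz]|z].
  have lz0 : 0 <= 2 ^+ l * z by rewrite mulr_ge0// ltW.
  have /andP[tl tr] := truncn_itv lz0.
  have tlt : (Num.trunc (2 ^+ l * z)%R < 2 ^ l)%N.
    by rewrite truncn_lt_nat// natrX -[ltRHS]mulr1 ltr_pM2l.
  exists (Num.trunc (2 ^+ l * z)) => //=.
  by rewrite Qz /= in_itv/= ler_pdivrMr// ltr_pdivlMr// ![z * _]mulrC tl.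
move=> [m /= ml]; case: ifPn => // Qm; rewrite /= in_itv/= ler_pdivrMr// ltr_pdivlMr// ![z * _]mulrC => mz.
rewrite /dyadic_set/= (truncn_def mz); split => //.
case/andP: mz => mz zm.
rewrite -(pmulr_rge0 z l0) (le_trans _ mz) ?ler0n//=.
rewrite -(ltr_pM2l l0) mulr1 (lt_le_trans zm)//.
by rewrite -natrX ler_nat.
Qed.

Lemma measurable_dyadic_set {R : realType} (l : nat) (Q : pred nat) :
  measurable (dyadic_set l Q : set R).
Proof.
by rewrite dyadic_set_bigcup; apply: bigsetU_measurable => m _; exact: measurable_itv.
Qed.

Lemma lebesgue_measure_dyadic_set {R : realType} (l : nat) (Q : pred nat) :
  lebesgue_measure (dyadic_set l Q : set R) =
  ((\sum_(m < 2 ^ l) Q m)%:R / 2 ^+ l)%:E.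
Proof.
have l0 : (0 : R) < 2 ^+ l by rewrite exprn_gt0.
rewrite dyadic_set_bigcup measure_bigsetU_ord_cond//; last first.
  apply/trivIsetP => i j _ _ ij; apply/seteqP; split => // z [] /=.
  rewrite !in_itv/= !ler_pdivrMr// !ltr_pdivlMr// => iz jz.
  by case/eqP: ij; apply/val_inj; rewrite /= -(truncn_def iz) (truncn_def jz).
transitivity (\sum_(m < 2 ^ l | Q m) ((2 ^+ l)^-1 : R)%:E)%E.
  apply: eq_bigr => m _; rewrite [LHS]lebesgue_measure_itv/=.
  rewrite lte_fin ltr_pM2r ?invr_gt0// ltr_nat ltnSn.
  by rewrite -EFinB -mulrBl -natrB// subSn// subnn mul1r.
rewrite sumEFin; congr EFin.
rewrite big_mkcond/= natr_sum mulr_suml; apply: eq_bigr => m _.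
by case: ifP; rewrite ?mul0r ?mul1r.
Qed.

Definition digit_set {R : realType} (k : nat) : set R := dyadic_set k odd.

(** With [t] the truncation at level [k], the one at level [k.-1] is [t %/ 2], so the digit is
    [t - 2 * (t %/ 2)], the parity of [t]. *)
Lemma bit_eq1 {R : realType} (k : nat) (z : R) : (0 < k)%N -> 0 <= z <= 1 ->
  bit k z = 1 <-> digit_set k z.
Proof.
case: k => // k _ /andP[z0]; rewrite le_eqVlt => /orP[/eqP->|z1].
  (* At [z = 1] both sides are false: the digit is [2 ^ k - 2 * 2 ^ k.-1 = 0], and [digit_set]
     excludes [1]. *)
  rewrite /bit !mulr1 -!natrX !pmulrn !intrKfloor/=; split; last by case; rewrite ltxx andbF.
  by rewrite expnS PoszM subrr mulr0z => /esym/eqP; rewrite oner_eq0.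
have floorE i : Num.floor (2 ^+ i * z) = Posz (Num.trunc (2 ^+ i * z)).
  by rewrite truncn_floor mulr_ge0 ?exprn_ge0// gez0_abs// floor_ge0 mulr_ge0 ?exprn_ge0.
rewrite /bit/= !floorE (@truncn_mul_exp2 _ z k 1 z0) addn1 expn1.
rewrite /digit_set /dyadic_set/= z0 z1.
set t := Num.trunc _.
have -> : Posz t - 2 * Posz (t %/ 2) = Posz (odd t) by lia.
case: (odd t); split => //=; last by case.
by move=> /esym/eqP; rewrite oner_eq0.
Qed.

Lemma lebesgue_measure_digit_set {R : realType} (k : nat) : (0 < k)%N ->
  lebesgue_measure (digit_set k : set R) = (2^-1)%:E.
Proof.
case: k => // k _; rewrite lebesgue_measure_dyadic_set.
have := sum_odd_divn_exp2 0 k; rewrite !addn0.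
under eq_bigr do rewrite expn0 divn1.
by move=> ->; rewrite natrX exprS invfM mulrCA divff ?mulr1// expf_neq0.
Qed.

(** Both digits are read off the integer formed by the first [l] digits: the [l]-th is its parity,
    the [k]-th its bit at place [l - k]. *)
Lemma lebesgue_measure_digit_setI {R : realType} (k l : nat) : (0 < k < l)%N ->
  lebesgue_measure (digit_set k `&` digit_set l : set R) = (4^-1)%:E.
Proof.
case: k => // k /= /subnKC <-; set i := (l - k.+2)%N.
have -> : digit_set k.+1 `&` digit_set (k.+2 + i) =
    dyadic_set (k.+2 + i) (fun m => odd m && odd (m %/ 2 ^ i.+1)) :> set R.
  apply/seteqP; split => z /=.
    move=> [[z01 oz1] [_ oz2]]; split => //; rewrite oz2/=.
    by rewrite addSnnS -truncn_mul_exp2 ?(andP z01).1.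
  by move=> [z01 /andP[]]; rewrite addSnnS -truncn_mul_exp2 ?(andP z01).1.
rewrite lebesgue_measure_dyadic_set sum_odd_odd_divn_exp2 natrX !addSn !exprS.
rewrite mulrA invfM mulrCA divff ?mulr1 ?expf_neq0//.
by rewrite -natrM.
Qed.

(** * Pairwise independent events and the digits of the sample *)

(* Second moment method: with N the number of the first n events that occur and
   a = n p, one has a^2 1_A + 2 a N <= N^2 + a^2 where A is the event that none
   occurs (this is (N - a)^2 >= 0, with all terms kept nonnegative); integrating
   gives P A <= 1 / a. *)
Lemma prob_none_pairwise_indep {d : measure_display} {T : measurableType d}
    {R : realType} (P : probability T R) (E : nat -> set T) (p : R) :
  0 < p -> (forall k, measurable (E k)) -> (forall k, P (E k) = p%:E) ->
  (forall k l, k != l -> P (E k `&` E l) = (p ^+ 2)%:E) ->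
  P (\bigcap_k ~` E k) = 0.
Proof.
move=> p0 mE PE PEI; set A := \bigcap_k _.
have mA : measurable A by apply: bigcap_measurableType => k _; exact: measurableC.
have mI (D : set T) : measurable D -> measurable_fun setT (EFin \o (\1_D : T -> R)).
  by move=> mD; apply/measurable_EFinP; exact: measurable_indic.
suff bound (n : nat) : (0 < n)%N -> fine (P A) <= (n%:R * p)^-1.
  have PA : P A = (fine (P A))%:E by rewrite fineK// fin_num_measure.
  rewrite PA; congr EFin; apply/eqP; rewrite eq_le fine_ge0// andbT.
  apply/ler_addgt0Pl => e e0; rewrite addr0.
  (* This number of events exceeds [(e * p)^-1], which brings the bound below [e]. *)
  have := bound (Num.trunc (e * p)^-1).+1 isT; move/le_trans; apply.
  have ep0 : 0 < (e * p)^-1 by rewrite invr_gt0 mulr_gt0.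
  have /andP[_ /ltW] := truncn_itv (ltW ep0).
  rewrite invfM ler_pdivrMr// => epn.
  by rewrite invf_ple// posrE mulr_gt0// ltr0n.
move=> n0; pose q := fine (P A); rewrite -/q; set a := n%:R * p.
have a0 : 0 < a by rewrite mulr_gt0// ltr0n.
pose S1 w := (\sum_(k < n) (\1_(E k) w)%:E)%E : \bar R.
pose S2 w := (\sum_(k < n) \sum_(l < n) (\1_(E k `&` E l) w)%:E)%E : \bar R.
have S1_ge0 w : (0 <= S1 w)%E by apply: sume_ge0 => k _; rewrite lee_fin.
have S2_ge0 w : (0 <= S2 w)%E.
  by apply: sume_ge0 => k _; apply: sume_ge0 => l _; rewrite lee_fin.
have mS1 : measurable_fun setT S1 by apply: emeasurable_sum => k; exact: mI.
have mS2 : measurable_fun setT S2.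
  by apply: emeasurable_sum => k; apply: emeasurable_sum => l; apply: mI; exact: measurableI.
have pointwise w : ((a ^+ 2)%:E * (\1_A w)%:E + (2 * a)%:E * S1 w <= S2 w + (a ^+ 2)%:E)%E.
  have -> : S2 w = (\sum_(k < n) \sum_(l < n) \1_(E k `&` E l) w)%:E.
    by rewrite /S2 -sumEFin; apply: eq_bigr => k _; rewrite sumEFin.
  rewrite /S1 sumEFin -!EFinM -!EFinD lee_fin.
  have -> : \sum_(k < n) \sum_(l < n) \1_(E k `&` E l) w =
      (\sum_(k < n) \1_(E k) w) ^+ 2 :> R.
    rewrite expr2 big_distrl/=; apply: eq_bigr => k _.
    by rewrite big_distrr/=; apply: eq_bigr => l _; rewrite indicI.
  have [Aw|nAw] := pselect (A w).
    rewrite big1; first by rewrite !mulr0 expr0n/= addr0 add0r indicE mem_set// mulr1.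
    by move=> k _; rewrite indicE memNset//; exact: Aw.
  rewrite [\1_A w]indicE memNset// mulr0 add0r.
  by rewrite -subr_ge0 [X in 0 <= X](_ : _ = (\sum_(k < n) \1_(E k) w - a) ^+ 2) ?sqr_ge0//; ring.
have intE k : (\int[P]_w (\1_(E k) w)%:E = p%:E)%E.
  by rewrite integral_indic// setIT; exact: PE.
have intEI k l : k != l -> (\int[P]_w (\1_(E k `&` E l) w)%:E = (p ^+ 2)%:E)%E.
  by move=> kl; rewrite integral_indic//; [rewrite setIT; exact: PEI|exact: measurableI].
have intS1 : (\int[P]_w S1 w = a%:E)%E.
  rewrite /S1 ge0_integral_sum//; [|by move=> k; exact: mI].
  rewrite (eq_bigr (fun=> p%:E)); last first.
    by move=> k _; exact: intE.
  by rewrite sumEFin sumr_const card_ord /a mulr_natl.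
(* The diagonal contributes [n * p = a]; each row has at most [n] further terms [p ^+ 2], in total
   at most [a ^+ 2]. *)
have intS2 : (\int[P]_w S2 w <= (a + a ^+ 2)%:E)%E.
  rewrite /S2 ge0_integral_sum//; last 2 first.
  - by move=> k; apply: emeasurable_sum => l; apply: mI; exact: measurableI.
  - by move=> k w _; apply: sume_ge0 => l _; rewrite lee_fin.
  rewrite (_ : a + a ^+ 2 = \sum_(k < n) (p + n%:R * p ^+ 2)); last first.
    by rewrite sumr_const card_ord -mulr_natl /a; ring.
  rewrite -sumEFin; apply: lee_sum => k _.
  rewrite ge0_integral_sum//; last by move=> l; apply: mI; exact: measurableI.
  rewrite (bigD1 k)//= setIid intE EFinD leeD2l//.
  rewrite (eq_bigr (fun=> (p ^+ 2)%:E)); last first.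
    by move=> l lk; rewrite intEI// eq_sym.
  rewrite sumEFin lee_fin sumr_const -[leLHS]mulr_natl ler_wpM2r ?sqr_ge0// ler_nat.
  by rewrite (leq_trans (max_card _))// card_ord.
have : (\int[P]_w ((a ^+ 2)%:E * (\1_A w)%:E + (2 * a)%:E * S1 w) <=
        \int[P]_w (S2 w + (a ^+ 2)%:E))%E.
  apply: ge0_le_integral => //.
  - by move=> w _; rewrite adde_ge0// mule_ge0// lee_fin ?sqr_ge0// mulr_ge0// ltW.
  - by apply: emeasurable_funD; apply: measurable_funeM => //; exact: mI.
  - by apply: emeasurable_funD.
rewrite ge0_integralD//; last 4 first.
- by move=> w _; rewrite mule_ge0// lee_fin// sqr_ge0.
- by apply: measurable_funeM; exact: mI.
- by move=> w _; rewrite mule_ge0// lee_fin mulr_ge0// ltW.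
- exact: measurable_funeM.
rewrite ge0_integralD//; last by move=> w _; rewrite lee_fin sqr_ge0.
rewrite !ge0_integralZl_EFin ?sqr_ge0//; last 2 first.
- by rewrite mulr_ge0// ltW.
- exact: mI.
have -> : (\int[P]_w (\1_A w)%:E = q%:E)%E.
  by rewrite integral_indic// setIT /q fineK// fin_num_measure.
have -> : (\int[P]_w (a ^+ 2)%:E = (a ^+ 2)%:E)%E.
  by rewrite integral_cst// -[RHS]mule1; congr (_ * _)%E; exact: probability_setT.
rewrite intS1 => /le_trans/(_ (leeD2r _ intS2)).
rewrite -!EFinM -!EFinD lee_fin => ub.
(* The integrated inequality gives [a ^+ 2 * q <= a]; multiplying the goal twice by [a] brings it to
   this form. *)
rewrite -(ler_pM2l a0) divff ?gt_eqF// -(ler_pM2l a0) mulr1.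
by move: ub; clearbody a q; clear; lra.
Qed.

Lemma uniform01_preimage {d : measure_display} {R : realType}
    {T : measurableType d} (P : probability T R) (X : {RV P >-> R}) (A : set R) :
  uniform01 X -> measurable A -> A `<=` `[0, 1] ->
  P (X @^-1` A) = lebesgue_measure A.
Proof.
move=> [_ unifX] mA A01; rewrite -[LHS]/(distribution P X A) unifX//.
rewrite /uniform_prob -[RHS]mul1e -integral_cst//; apply: eq_integral => x /set_mem/A01/=.
by rewrite in_itv/= /uniform_pdf => ->; rewrite subr0 invr1.
Qed.

Lemma digit_set_sub01 {R : realType} (k : nat) : digit_set k `<=` (`[0, 1] : set R).
Proof. by move=> z [/andP[z0 z1] _]; rewrite /= in_itv/= z0 ltW. Qed.

Lemma prob_independent_uniform01 {d : measure_display} {R : realType}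
    {Omega : measurableType d} (P : probability Omega R)
    (xi : nat -> {RV P >-> R}) (J : {fset nat}) (A : set R) (q : R) :
  mutually_independent xi -> (forall i, uniform01 (xi i)) ->
  measurable A -> A `<=` `[0, 1] -> lebesgue_measure A = q%:E ->
  P (\bigcap_(i in [set` J]) (xi i @^-1` A)) = (q ^+ size J)%:E.
Proof.
move=> xi_indep xi_unif mA A01 Aq; rewrite xi_indep//.
rewrite (eq_bigr (fun=> q%:E)); last by move=> i _; rewrite uniform01_preimage.
rewrite big_const_seq count_predT; elim: (size J) => [|m IHm]; first by rewrite expr0.
by rewrite iterS IHm -EFinM exprS.
Qed.

(* The events [bit k (xi i w) = 1 for all i <= n], k > K, are pairwise independent
   with a common positive probability. *)
Lemma ae_digits_infinitely_often {d : measure_display} {R : realType}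
    {Omega : measurableType d} (P : probability Omega R)
    (xi : nat -> {RV P >-> R}) :
  mutually_independent xi -> (forall i, uniform01 (xi i)) ->
  \forall w \ae P, forall n K : nat, exists2 k, (K < k)%N &
    forall i, (0 < i <= n)%N -> bit k (xi i w) = 1.
Proof.
(* There are countably many pairs [n], [K], so one null set for each pair suffices. *)
move=> xi_indep xi_unif; apply: ae_foralln => n; apply: ae_foralln => K.
pose J := [fset i in iota 1 n]%fset.
(* The shift by [K.+1] makes every digit index positive and larger than [K]. *)
pose E k := \bigcap_(i in [set` J]) (xi i @^-1` digit_set (K.+1 + k)).
have mE k : measurable (E k).
  apply: fin_bigcap_measurable => // i _.
  by rewrite -[X in measurable X]setTI; apply: measurable_funP => //; exact: measurable_dyadic_set.
have PE0 : P (\bigcap_k ~` E k) = 0.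
  apply: (@prob_none_pairwise_indep _ _ _ P E (2^-1 ^+ size J)) => //.
  - move=> k; apply: prob_independent_uniform01 => //.
    + exact: measurable_dyadic_set.
    + exact: digit_set_sub01.
    + exact: lebesgue_measure_digit_set.
  - have PEI k l : (k < l)%N -> P (E k `&` E l) = ((2^-1 ^+ size J) ^+ 2)%:E.
      move=> kl; rewrite exprAC (_ : 2^-1 ^+ 2 = 4^-1); last by rewrite exprVn -natrX.
      (* Intersecting sample by sample keeps the form of a product event, now with probability
         [4^-1] per sample. *)
      rewrite [E k `&` E l](_ : _ = \bigcap_(i in [set` J])
        (xi i @^-1` (digit_set (K.+1 + k) `&` digit_set (K.+1 + l)))); last first.
        by rewrite /E -bigcapI; apply: eq_bigcapr => i _.
      apply: prob_independent_uniform01 => //.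
      + by apply: measurableI; exact: measurable_dyadic_set.
      + by move=> z [/digit_set_sub01].
      + by rewrite lebesgue_measure_digit_setI// addSn/= ltnS ltn_add2l.
    move=> k l; rewrite neq_ltn => /orP[|] kl; first exact: PEI.
    by rewrite setIC; exact: PEI.
exists (\bigcap_k ~` E k); split => //.
  by apply: bigcap_measurableType => k _; exact: measurableC.
move=> w /= nw k _ Ekw; apply: nw; exists (K.+1 + k)%N; first by rewrite addSn ltnS leq_addr.
move=> i /andP[i0 iN]; apply/(@bit_eq1 R _ _ _ _) => //.
  by have [+ _] := xi_unif i => /(_ w); rewrite in_itv.
by apply: Ekw; rewrite /= !inE mem_iota i0 add1n ltnS.
Qed.

(** * The intervals [B k], and [f] as a Lebesgue measure *)

(** The inverse of [0] is [0], so the radius vanishes and the strict inequality fails. Unions over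
    all [k] thus agree with unions over [k >= 1]. *)
Lemma B0_set0 {R : realType} : B 0 = set0 :> set R.
Proof.
by apply/seteqP; split => // x; rewrite /B/= expr0n/= mulr0 invr0 ltNge normr_ge0.
Qed.

Lemma B_disjoint {R : realType} (k l : nat) (x : R) : (k < l)%N -> B k x -> ~ B l x.
Proof.
case: k => [|k] kl; first by rewrite B0_set0.
have k0 : 0 < k.+1%:R :> R by rewrite ltr0n.
have l0 : 0 < l%:R :> R by rewrite ltr0n (leq_trans _ kl).
have kl1 : k.+1%:R + 1 <= l%:R :> R by rewrite natr1 ler_nat.
(* With u = 1/k and v = 1/l, u - v >= u^2 / (1 + u) >= u^2 / 2 exceeds the sum of
   the radii u^2 / 4 and v^2 / 4. *)
rewrite /B/= !invfM.
have : (k.+1%:R)^-1 * k.+1%:R = 1 :> R by rewrite mulVf// gt_eqF.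
have : (l%:R)^-1 * l%:R = 1 :> R by rewrite mulVf// gt_eqF.
have : 0 < (k.+1%:R)^-1 :> R by rewrite invr_gt0.
have : 0 < (l%:R)^-1 :> R by rewrite invr_gt0.
have : 1 <= k.+1%:R :> R by rewrite ler1n.
move: k0 l0 kl1; move: (k.+1%:R : R) (l%:R : R) => a b.
move: (a^-1) (b^-1) => u v a0 b0 ab a1 v0 u0 vb ua.
have u1 : u <= 1 by nra.
have uv : v * (1 + u) <= u.
  have -> : v * (1 + u) = u * v * (a + 1) by rewrite -[X in v * (X + _)]ua; ring.
  rewrite [leRHS](_ : u = u * v * b); last by rewrite -mulrA vb mulr1.
  by rewrite ler_pM2l// mulr_gt0.
have vu : v <= u by nra.
rewrite !ltr_norml => /andP[h1 h2] /andP[h3 h4].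
have d1 : u - v < u ^+ 2 / 2 by nra.
have d2 : u ^+ 2 <= (u - v) * (1 + u) by nra.
nra.
Qed.

Lemma trivIset_B {R : realType} : trivIset setT (B : nat -> set R).
Proof.
apply/trivIsetP => i j _ _; rewrite neq_ltn => /orP[|] ij; apply/seteqP; split => // x [Bi Bj].
  exact: (B_disjoint _ _ _ ij Bi Bj).
exact: (B_disjoint _ _ _ ij Bj Bi).
Qed.

Lemma measurable_B {R : realType} (k : nat) : measurable (B k : set R).
Proof.
rewrite (_ : B k = ball (k%:R^-1 : R) ((4 * k%:R ^+ 2)^-1)); first exact: measurable_ball.
by apply/seteqP; split => x; rewrite /B /ball/= distrC.
Qed.

Lemma bit_01 {R : realType} (k : nat) (z : R) : (0 < k)%N -> bit k z = 0 \/ bit k z = 1.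
Proof.
case: k => // k _; rewrite /bit/= exprS -mulrA; move: (2 ^+ k * z) => y.
have /andP[y1 y2] := floor_itv y.
have h1 : 2 * Num.floor y <= Num.floor (2 * y).
  by rewrite floor_ge_int intrM ler_pM2l.
have h2 : Num.floor (2 * y) < 2 * Num.floor y + 2.
  by rewrite floor_lt_int intrD intrM; move: y2; rewrite intrD; lra.
have [->|->] : Num.floor (2 * y) = 2 * Num.floor y \/
               Num.floor (2 * y) = 2 * Num.floor y + 1 by lia.
  by left; rewrite subrr.
by right; rewrite addrAC subrr add0r.
Qed.

(* [g z] is the indicator function of this set, hence [f z] is an increment of
   Lebesgue measure. *)
Definition digit_union {R : realType} (z : R) : set R :=
  \bigcup_(k in [set k | bit k z = 1]) B k.

Lemma measurable_digit_union {R : realType} (z : R) : measurable (digit_union z).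
Proof. by apply: bigcup_measurable => k _; exact: measurable_B. Qed.

(** At most one [B k] contains [x], so the partial sums are eventually constant: [0] if there is
    none, otherwise the digit [bit k z], which is [0] or [1]. *)
Lemma g_indic {R : realType} (z x : R) : g z x = \1_(digit_union z) x.
Proof.
have [[k _ Bkx]|nB] := pselect ((\bigcup_k B k) x); last first.
  rewrite indicE memNset; last by move=> [k _ Bkx]; apply: nB; exists k.
  apply: lim_near_cst => //; apply: nearW => n; apply: big1 => k _.
  by rewrite indicE memNset ?mul0r// => Bkx; apply: nB; exists k.
have notB l : l != k -> ~ B l x.
  by rewrite neq_ltn => /orP[|] lk Blx; [exact: (B_disjoint _ _ _ lk Blx)|
    exact: (B_disjoint _ _ _ lk Bkx)].
have k0 : (0 < k)%N by move: Bkx; case: (k) => //; rewrite B0_set0.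
transitivity (bit k z).
  apply: lim_near_cst => //; near=> n.
  rewrite (bigD1_seq k) ?iota_uniq//=; last first.
    by rewrite mem_index_iota k0/=; near: n; exact: nbhs_infty_gt.
  rewrite indicE mem_set// mul1r big1 ?addr0// => l lk.
  by rewrite indicE memNset ?mul0r//; exact: notB.
have [bk|bk] := bit_01 _ z k0; rewrite bk indicE.
  rewrite memNset// => -[l bl Blx]; have [lk|/notB//] := eqVneq l k.
  by move: bl; rewrite lk/= bk => /esym/eqP; rewrite oner_eq0.
by rewrite mem_set//; exists k.
Unshelve. all: by end_near. Qed.

Lemma f_measure {R : realType} (z y : R) :
  f z y = fine (lebesgue_measure (digit_union z `&` `[0, Num.max y 0])).
Proof.
rewrite /f /Rintegral; congr fine.
rewrite -integral_indic//; last exact: measurable_digit_union.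
by apply: eq_integral => x _; rewrite g_indic.
Qed.

(** Finiteness is what lets [fine] commute with the sums, products and inequalities of measures
    below. *)
Lemma lebesgue_measureI_itv_fin {R : realType} (A : set R) (i : interval R) (a b : R) :
  measurable A -> [set` i] `<=` `[a, b] ->
  lebesgue_measure (A `&` [set` i]) \is a fin_num.
Proof.
move=> mA iab; rewrite ge0_fin_numE//.
apply: (@le_lt_trans _ _ (lebesgue_measure (`[a, b]%classic : set R))).
  apply: le_measure; rewrite ?inE//; first exact: measurableI.
  by move=> x [_ /iab].
by rewrite lebesgue_measure_itv/=; case: ifP; rewrite ?ltry// -EFinB ltry.
Qed.

Lemma fine_measureI_itvB {R : realType} (A : set R) (a b : R) :
  measurable A -> 0 <= a <= b ->
  fine (lebesgue_measure (A `&` `[0, b])) =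
  fine (lebesgue_measure (A `&` `[0, a])) + fine (lebesgue_measure (A `&` `]a, b])).
Proof.
move=> mA /andP[a0 ab].
rewrite -fineD; last 2 first.
- by apply: (@lebesgue_measureI_itv_fin _ _ _ 0 a).
- apply: (@lebesgue_measureI_itv_fin _ _ _ a b) => // x /=.
  by rewrite !in_itv/= => /andP[/ltW -> ->].
congr fine; rewrite -measureU//; try exact: measurableI; last first.
  apply/seteqP; split => // x [[_ /=]]; rewrite !in_itv/= => /andP[_ xa] [_ /andP[]].
  by rewrite ltNge xa.
rewrite -setIUr; congr (lebesgue_measure (_ `&` _)).
apply/seteqP; split => x /=; rewrite !in_itv/=.
  by move=> /andP[x0 xb]; case: (leP x a) => xa; [left; rewrite x0|right; rewrite xb].
by move=> [/andP[-> xa]|/andP[ax ->]]; rewrite ?(le_trans xa)// (le_trans a0 (ltW ax)).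
Qed.

(** The whole of []a, b]] lies in [digit_union z], so the increment is its full length. *)
Lemma f_increment {R : realType} (z : R) (k : nat) (a b : R) :
  0 <= a <= b -> bit k z = 1 -> `]a, b] `<=` (B k : set R) -> f z b - f z a = b - a.
Proof.
move=> /andP[a0 ab] bk abB.
rewrite !f_measure !max_l//; last exact: le_trans ab.
rewrite (@fine_measureI_itvB _ _ a b) ?a0//; last exact: measurable_digit_union.
rewrite addrAC subrr add0r setIidr; last by move=> x /abB; exists k.
rewrite lebesgue_measure_itv/= lte_fin; case: ltP => //= ba.
by rewrite (@le_anti _ _ a b) ?ab ?ba ?subrr.
Qed.

(** * The expected function and its increments *)

(** By disjointness, [f (X w) y] is the sum over [k] of the measure of [B k] within the interval
    times the indicator of the [k]-th digit being 1. Sum and expectation commute as all terms are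
    nonnegative, and each digit event has probability [2^-1]. *)
Lemma expectation_f {d : measure_display} {R : realType}
    {T : measurableType d} (P : probability T R) (X : {RV P >-> R}) (y : R) :
  uniform01 X ->
  ('E_P[fun w => f (X w) y] =
   (2^-1)%:E * lebesgue_measure (\bigcup_k (B k : set R) `&` `[0%R, Num.max y 0%R]))%E.
Proof.
move=> Xu; set I := `[0, Num.max y 0]%classic.
have mBI k : measurable (B k `&` I : set R).
  by apply: measurableI; [exact: measurable_B|exact: measurable_itv].
have tBI (D : set nat) : trivIset D (fun k => B k `&` I : set R).
  by apply: trivIset_setIr; apply: sub_trivIset trivIset_B.
have mX k : measurable (X @^-1` digit_set k).
  by rewrite -[X in measurable X]setTI; apply: measurable_funP => //; exact: measurable_dyadic_set.
pose u k w : \bar R := (lebesgue_measure (B k `&` I) * (\1_(X @^-1` digit_set k) w)%:E)%E.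
have fE w : ((f (X w) y)%:E = \sum_(k <oo) u k w)%E.
  rewrite f_measure fineK; last first.
    by apply: (@lebesgue_measureI_itv_fin _ _ _ 0 (Num.max y 0)) => //; exact: measurable_digit_union.
  rewrite setI_bigcupl measure_bigcup//=; last by move=> k _; exact: mBI.
  rewrite [LHS]eseries_mkcond; apply: eq_eseriesr => k _.
  rewrite /u; case: k => [|k]; first by rewrite B0_set0 set0I measure0 mul0e; case: ifP.
  have Xw : 0 <= X w <= 1 by have [/(_ w)] := Xu; rewrite in_itv.
  rewrite indicE; have [bk|bk] := pselect (bit k.+1 (X w) = 1).
    by rewrite !mem_set ?mule1//; apply/(@bit_eq1 _ k.+1).
  by rewrite !memNset ?mule0// => /(@bit_eq1 _ k.+1 _ isT Xw).
rewrite unlock (eq_integral _ _ (fun w _ => fE w)) integral_nneseries//; last 2 first.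
- move=> k; apply: emeasurable_funM => //.
  by apply/measurable_EFinP; exact: measurable_indic.
- by move=> k w _; rewrite mule_ge0// lee_fin.
rewrite setI_bigcupl measure_bigcup//=; last by move=> k _; exact: mBI.
rewrite [in RHS]eseries_mkcond -nneseriesZl; last by move=> k _; case: ifP.
apply: eq_eseriesr => k _; rewrite mem_set//.
rewrite ge0_integralZl//; last by apply/measurable_EFinP; exact: measurable_indic.
rewrite integral_indic// setIT muleC.
(* Index [0] is apart: [digit_set 0] does not have measure [2^-1], but [B 0] is empty. *)
case: k => [|k]; first by rewrite B0_set0 set0I measure0 !mule0.
congr (_ * _)%E; rewrite -(@lebesgue_measure_digit_set R k.+1)//.
apply: uniform01_preimage => //; [exact: measurable_dyadic_set|exact: digit_set_sub01].
Qed.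

(** The increment is half the measure of a part of []Num.max a 0, Num.max b 0]], and clamping at [0]
    does not increase distances. Both signs are covered because the Clarke derivative at [0] also
    looks to the left. *)
Lemma mean_f_increment {d : measure_display} {R : realType}
    {T : measurableType d} (P : probability T R) (X : {RV P >-> R}) (a b : R) :
  uniform01 X -> a <= b ->
  fine 'E_P[fun w => f (X w) b] - fine 'E_P[fun w => f (X w) a] <= (b - a) / 2.
Proof.
move=> Xu ab; rewrite !expectation_f//; set U := \bigcup_k _.
have mU : measurable U by apply: bigcupT_measurable => k; exact: measurable_B.
have Ufin y : lebesgue_measure (U `&` `[0, y]) \is a fin_num.
  exact: (@lebesgue_measureI_itv_fin _ _ _ 0 y).
have ab' : 0 <= Num.max a 0 <= Num.max b 0 by rewrite le_max lexx orbT le_max2.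
rewrite !fineM//= (@fine_measureI_itvB _ _ _ _ mU ab') mulrDr addrAC subrr add0r mulrC.
rewrite ler_pM2r ?invr_gt0//.
apply: (@le_trans _ _ (fine (lebesgue_measure (`]Num.max a 0, Num.max b 0]%classic : set R)))).
  apply: fine_le; [| |apply: le_measure].
  - apply: (@lebesgue_measureI_itv_fin _ _ _ (Num.max a 0) (Num.max b 0)) => // x /=.
    by rewrite !in_itv/= => /andP[/ltW -> ->].
  - by rewrite lebesgue_measure_itv/=; case: ifP.
  - by rewrite inE; apply: measurableI.
  - by rewrite inE.
  - by move=> x [].
rewrite lebesgue_measure_itv/= lte_fin; case: ltP => /= _; last by rewrite subr_ge0.
by case: (leP a 0); case: (leP b 0); lra.
Qed.

(** * Bounds and membership for the Clarke subdifferential; excess and lower limit *)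

(** In direction [1], every difference quotient with positive step is at most [c], hence so is their
    upper limit. *)
Lemma clarke_subdiff_le {R : realType} (phi : R -> R) (x c s : R) :
  (forall a b, a <= b -> phi b - phi a <= c * (b - a)) ->
  clarke_subdiff phi x s -> s <= c.
Proof.
move=> phic /(_ 1); rewrite mulr1 => /le_trans h; rewrite -lee_fin; apply: h.
rewrite /clarke_dd limf_esupE; apply: ereal_inf_le.
exists (ereal_sup ((fun p : R * R => ((phi (p.1 + p.2 * 1) - phi p.1) / p.2)%:E) @`
  (setT `*` [set t | 0 < t]))).
  exists (setT `*` [set t | 0 < t]) => //.
  exists (setT, [set t | 0 < t]) => //; split => /=; first exact: filterT.
  exact: nbhs_right_gt.
apply: ge_ereal_sup => _ [[y t] [_ /= t0] <-]; rewrite lee_fin mulr1.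
rewrite ler_pdivrMr//; have := phic y (y + t); rewrite lerDl ltW// => /(_ isT).
by rewrite [y + t - y]addrAC subrr add0r.
Qed.

(** Arbitrarily near [x] there are points [c] around which [phi] is affine of slope [s]. Small steps
    from [c] give quotients equal to [s * v], so the supremum over each neighbourhood is at least
    [s * v]. *)
Lemma clarke_subdiff_slope {R : realType} (phi : R -> R) (x s : R) :
  (forall e, 0 < e -> exists c r : R, [/\ `|c - x| < e, 0 < r &
    forall h, `|h| < r -> phi (c + h) - phi c = s * h]) ->
  clarke_subdiff phi x s.
Proof.
move=> slope v; rewrite /clarke_dd limf_esupE; apply: le_ereal_inf_tmp => _ /=
  [A [[U V] /= [/nbhs_ballP[e /= e0 eU] V0] UVA] <-].
have [c [r [cx r0 hr]]] := slope e e0.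
have [t [Vt t0 tv]] : exists t, [/\ V t, 0 < t & `|t * v| < r].
  have : \forall t \near 0^'+, [/\ V t, 0 < t & `|t * v| < r].
    (* Adding [1] keeps the divisor positive when [v = 0]. *)
    have v1 : 0 < `|v| + 1 by rewrite ltr_wpDl.
    near=> t; have t0 : 0 < t by near: t; exact: nbhs_right_gt.
    split => //; first by near: t.
    have : t < r / (`|v| + 1) by near: t; exact: (nbhs_right_lt (divr_gt0 r0 v1)).
    rewrite ltr_pdivlMr//; apply: le_lt_trans.
    by rewrite normrM gtr0_norm// ler_pM2l// lerDl.
  by move=> /(@filter_ex _ _ (at_right_proper_filter 0)).
apply: ereal_sup_ubound; exists (c, t) => /=.
  by apply: UVA; split => //=; apply: eU; rewrite /ball/= distrC.
by rewrite hr// mulrCA [_ / t]mulrC mulKf// gt_eqF.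
Unshelve. all: by end_near. Qed.

(** The single point [z] witnesses the excess, as all of [D] lies at least [e] to its left. *)
Lemma exs_ge {R : realType} (C D : set R) (z c e : R) : C z ->
  (forall w, D w -> w <= c) -> c + e <= z -> (e%:E <= exs C D)%E.
Proof.
move=> Cz Dc cez; apply: (@le_trans _ _ (ereal_inf [set `|z - w|%:E | w in D])).
  apply: le_ereal_inf_tmp => _ [w /Dc wc <-]; rewrite lee_fin.
  by apply: le_trans (ler_norm _); lra.
by apply: ereal_sup_ubound; exists z.
Qed.

Lemma limn_einf_ge {R : realType} (u : nat -> \bar R) (c : \bar R) :
  (\forall n \near \oo, (c <= u n)%E) -> (c <= limn_einf u)%E.
Proof.
move=> [N _ cu]; rewrite limn_einf_lim; apply: lime_ge; first exact: is_cvg_einfs.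
near=> n; apply: le_ereal_inf_tmp => _ [m /= nm <-]; apply: cu => /=.
by apply: leq_trans nm; near: n; exact: nbhs_infty_ge.
Unshelve. all: by end_near. Qed.

(** * The slope of the sample mean on a common interval, and the conclusion *)

(** The segment between [k%:R^-1] and [k%:R^-1 + h] lies in [B k], so each of the [nu] summands
    changes by exactly [h]. *)
Lemma sample_mean_slope {R : realType} (z : nat -> R) (nu k : nat) (h : R) :
  (0 < nu)%N -> (0 < k)%N -> (forall i, (0 < i <= nu)%N -> bit k (z i) = 1) ->
  `|h| < (4 * k%:R ^+ 2)^-1 ->
  nu%:R^-1 * \sum_(1 <= i < nu.+1) f (z i) (k%:R^-1 + h) -
  nu%:R^-1 * \sum_(1 <= i < nu.+1) f (z i) k%:R^-1 = h.
Proof.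
move=> nu0 k0 bits hk; rewrite -mulrBr -sumrB.
have k1 : 1 <= k%:R :> R by rewrite ler1n.
(* The radius of [B k] is at most its centre, so the segment stays in the nonnegative half-line
   where [f_increment] applies. *)
have rk : (4 * k%:R ^+ 2)^-1 <= k%:R^-1 :> R.
  rewrite lef_pV2 ?posrE ?mulr_gt0 ?exprn_gt0 ?ltr0n// expr2; nra.
have kh : 0 <= k%:R^-1 + h by move: hk; rewrite ltr_norml => /andP[+ _]; lra.
rewrite (eq_big_nat _ _ (F2 := fun=> h)); last first.
  move=> i /bits bi.
  have sub a b : `|a - k%:R^-1| <= `|h| -> `|b - k%:R^-1| <= `|h| -> `]a, b] `<=` (B k : set R).
    move=> ah bh x /=; rewrite in_itv/= => /andP[ax xb]; apply: le_lt_trans hk.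
    by move: ah bh; rewrite !ler_norml => /andP[? ?] /andP[? ?]; apply/andP; split; lra.
  have ck : `|k%:R^-1 - k%:R^-1 : R| <= `|h| by rewrite subrr normr0.
  have chk : `|k%:R^-1 + h - k%:R^-1| <= `|h| by rewrite addrAC subrr add0r.
  have [h0|/ltW h0] := leP 0 h.
    rewrite (@f_increment _ _ k)//; last exact: sub.
      by rewrite addrAC subrr add0r.
    by rewrite invr_ge0 ler0n/= lerDl.
  (* For negative [h] the endpoints change roles. *)
  rewrite -opprB (@f_increment _ _ k)//; last exact: sub.
    by rewrite opprB addrAC subrr add0r.
  by rewrite kh/= gerDl.
by rewrite big_const_nat iter_addr_0 subn1/= -[h *+ _]mulr_natl mulKf// pnatr_eq0 -lt0n.
Qed.

(* xi 0 is the generic random variable, xi 1, xi 2, and so on are the sample. *)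
Theorem corollary4 (R : realType) (d : measure_display)
    (Omega : measurableType d) (P : probability Omega R)
    (P_complete : measure_is_complete P)
    (xi : nat -> {RV P >-> R})
    (xi_indep : mutually_independent xi)
    (xi_unif : forall i : nat, uniform01 (xi i)) :
  exists x : R, x \in `[0, 1] /\
    \forall w \ae P,
      ((2^-1)%:E <=
        limn_einf (fun nu : nat =>
          exs (clarke_subdiff
                 (fun y : R => nu%:R^-1 * \sum_(1 <= i < nu.+1) f (xi i w) y)%R x)
              (clarke_subdiff
                 (fun y : R => fine 'E_P[fun w' => f (xi 0%N w') y]) x)))%E.
Proof.
exists 0; split; first by rewrite in_itv/= lexx ler01.
apply: filterS (ae_digits_infinitely_often _ _ xi_indep xi_unif) => w digits.
apply: limn_einf_ge; near=> nu.
have nu0 : (0 < nu)%N by near: nu; exact: nbhs_infty_gt.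
(* The slope [1] belongs to the first subdifferential, the second lies below [2^-1], and the gap is
   [2^-1]. *)
apply: (@exs_ge _ _ _ 1 2^-1); last by rewrite [leLHS](_ : _ = 1)//; lra.
  apply: clarke_subdiff_slope => e e0.
  (* An index above the truncation of [e^-1] puts the centre [k%:R^-1] within [e] of [0]. *)
  have [k Kk bits] := digits nu (Num.trunc e^-1).
  have k0 : (0 < k)%N by exact: leq_ltn_trans Kk.
  have kR : 0 < k%:R :> R by rewrite ltr0n.
  exists k%:R^-1, (4 * k%:R ^+ 2)^-1; split.
  - rewrite subr0 gtr0_norm ?invr_gt0// invf_plt ?posrE//.
    by rewrite -truncn_lt_nat// invr_ge0 ltW.
  - by rewrite invr_gt0 mulr_gt0 ?exprn_gt0.
  - by move=> h hk; rewrite mul1r; exact: (@sample_mean_slope _ (fun i => xi i w)).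
move=> s; apply: clarke_subdiff_le => a b ab.
by rewrite mulrC; exact: mean_f_increment.
Unshelve. all: by end_near. Qed.
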